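(* Let $(c_i(z))_{i=1}^n$ be a finite sequence of rational functions in $K(z)$. Then $(c_i)$ is $k$-precalm if and only if for every $k$-anxious $\alpha\in K$ and every $(a_i)\in A_\alpha$ one has $\mathrm{clm}_{\alpha,(a_i)}(c_i)\ge 0$.
   Context: Throughout, $K$ is an algebraically closed field of characteristic $0$ or $p>0$, and $k\ge 2$ is an integer; if $\operatorname{char}K=p>0$ then $k$ is coprime to $p$. $v_\alpha$ is the $(z-\alpha)$-adic valuation on $K(z)$, $v_\alpha(0)=+\infty$. A number $\alpha\in K$ is $k$-calm if $\alpha=0$ or $\alpha$ is a root of unity of order not coprime to $k$; otherwise it is $k$-anxious. A rational function is $k$-calm if it has no poles at $k$-anxious numbers; a sequence is $k$-calm if all its terms are. For a nonzero $h\in K(z)$ define $h^*(c_i)=\bigl(\tfrac{h(z^{k^i})}{h(z)}c_i(z)\bigr)_{i=1}^n$. The sequence $(c_i)$ is $k$-precalm if there is a nonzero polynomial $h\in K[z]$ with $h^*(c_i)$ $k$-calm. For a sequence $(a_i)$ write $\overline a_i=\sum_{j=0}^{i-1}a_j$ ($\overline a_0=0$). For $k$-anxious $\alpha$: if $\alpha$ is not a root of unity, $A_\alpha$ is the set of infinite sequences $(a_i)_{i\ge0}$ with $a_i\in\{1,\dots,n\}$; if $\alpha$ is a root of unity, $A_\alpha$ is the set of finite sequences $(a_i)_{i=0}^{\mu-1}$ ($\mu\ge1$) with $a_i\in\{1,\dots,n\}$ and $\alpha^{k^{\overline a_\mu}}=\alpha$. The calmness is $\mathrm{clm}_{\alpha,(a_i)}(c_i)=\sum_i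 v_{\alpha^{k^{\overline a_i}}}(c_{a_i})$, summed over $0\le i\le\mu-1$ in the root-of-unity case and over all $i\ge0$ otherwise (this sum has finitely many nonzero terms or contains a term $+\infty$). *)

(* Defs.v *)
From HB Require Import structures.
From mathcomp Require Import all_boot all_order all_algebra.
From mathcomp Require Import boolp classical_sets fsbigop constructive_ereal.

Set Implicit Arguments.
Unset Strict Implicit.
Unset Printing Implicit Defensive.

Import Order.TTheory GRing.Theory Num.Theory.
Local Open Scope ring_scope.

Notation "x %:F" := (@FracField.tofrac _ x) : ring_scope.

(* The field K(z). *)
Notation ratfun K := {fraction {poly K}}.

Section RationalFunctions.
Variable K : fieldType.
Implicit Types (x : K) (p q : {poly K}) (f : ratfun K).

(* The (z - x)-adic valuation; [val_at_frac] shows that it does not depend on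
   the representative chosen by [repr]. *)
Definition val_at x f : \bar int :=
  if f == 0 then +oo%E
  else ((mup x \n_(repr f))%:Z - (mup x \d_(repr f))%:Z)%:E.

Definition has_pole f x : Prop := (val_at x f < 0)%E.

(* f(z) |-> f(z^m), for m > 0; see [subst_pow_frac]. *)
Definition subst_pow (m : nat) f : ratfun K :=
  (\n_(repr f) \Po 'X^m)%:F / (\d_(repr f) \Po 'X^m)%:F.

Lemma ratfun_repr f : f = (\n_(repr f))%:F / (\d_(repr f))%:F.
Proof.
rewrite -{1}[f]reprK !piE /FracField.mulf /FracField.invf.
rewrite !numden_Ratio ?oner_eq0 ?mulr1 ?mul1r ?denom_ratioP //.
by rewrite Ratio_numden.
Qed.

Lemma repr_frac p q : q != 0 ->
  p * \d_(repr (p%:F / q%:F)) = q * \n_(repr (p%:F / q%:F)).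
Proof.
move=> q0; have /eqP := ratfun_repr (p%:F / q%:F).
rewrite eqr_div ?tofrac_eq0 ?denom_ratioP //.
by rewrite -!tofracM tofrac_eq => /eqP; rewrite [in RHS]mulrC.
Qed.

Lemma numer_repr_eq0 f : (\n_(repr f) == 0) = (f == 0).
Proof.
rewrite [in RHS](ratfun_repr f) mulf_eq0 invr_eq0 !tofrac_eq0.
by rewrite (negbTE (denom_ratioP _)) orbF.
Qed.

Lemma val_at_frac x p q : p != 0 -> q != 0 ->
  val_at x (p%:F / q%:F) = ((mup x p)%:Z - (mup x q)%:Z)%:E.
Proof.
move=> p0 q0; rewrite /val_at.
have f0 : p%:F / q%:F != 0 :> ratfun K.
  by rewrite mulf_neq0 ?invr_eq0 ?tofrac_eq0.
rewrite (negbTE f0).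
have n0 : \n_(repr (p%:F / q%:F)) != 0 :> {poly K} by rewrite numer_repr_eq0.
have /(congr1 (mup x)) := repr_frac p q0.
rewrite !mupM ?denom_ratioP // => /(congr1 Posz); rewrite !PoszD => e.
congr (_%:E); apply/eqP.
by rewrite subr_eq addrAC eq_sym subr_eq e addrC.
Qed.

Lemma subst_pow_frac m p q : (0 < m)%N -> q != 0 ->
  subst_pow m (p%:F / q%:F) = (p \Po 'X^m)%:F / (q \Po 'X^m)%:F.
Proof.
move=> m0 q0; have cX (r : {poly K}) : r != 0 -> r \Po 'X^m != 0.
  by move=> r0; rewrite comp_poly_eq0 ?size_polyXn.
rewrite /subst_pow; apply/eqP.
rewrite eqr_div ?tofrac_eq0 ?cX ?denom_ratioP //.
rewrite -!tofracM -!rmorphM /= (repr_frac p q0).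
by rewrite [\n_ _ * q]mulrC.
Qed.

Lemma subst_pow_poly m p : (0 < m)%N -> subst_pow m p%:F = (p \Po 'X^m)%:F.
Proof.
move=> m0; have := @subst_pow_frac m p 1 m0 (oner_neq0 _).
by rewrite comp_polyC tofrac1 !divr1.
Qed.

End RationalFunctions.

Section Calm.
Variables (K : fieldType) (k : nat).
Implicit Types x : K.

Definition unity_root x : Prop := exists2 m, (0 < m)%N & m.-unity_root x.

Definition calm_number x : Prop :=
  x = 0 \/ exists2 m, m.-primitive_root x & ~~ coprime m k.

Definition anxious_number x : Prop := ~ calm_number x.

Definition calm_ratfun (f : ratfun K) : Prop :=
  forall x, anxious_number x -> ~ has_pole f x.

Section Sequences.
Variable n : nat.

(* (c_1, ..., c_n) is indexed by 'I_n: position i : 'I_n stands for the index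
   i.+1. *)
Implicit Types c : 'I_n -> ratfun K.

Definition calm_seq c : Prop := forall i, calm_ratfun (c i).

Definition star (h : ratfun K) c : 'I_n -> ratfun K :=
  fun i => subst_pow (k ^ i.+1) h / h * c i.

Definition precalm c : Prop :=
  exists2 h : {poly K}, h != 0 & calm_seq (star h%:F c).

(* Finite sequences (a_0, ..., a_(mu-1)) and infinite sequences (a_0, a_1, ...)
   over {1, ..., n}, each letter i.+1 being represented by i : 'I_n. *)
Inductive word : Type :=
  | FinWord (mu : nat) of 'I_mu -> 'I_n
  | InfWord of nat -> 'I_n.

Definition fin_psum mu (a : 'I_mu -> 'I_n) (i : nat) : nat :=
  \sum_(j < mu | (j < i)%N) (a j).+1.

Definition inf_psum (a : nat -> 'I_n) (i : nat) : nat :=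
  \sum_(j < i) (a j).+1.

Definition admissible x : set word := fun w =>
  match w with
  | @FinWord mu a =>
      [/\ unity_root x, (0 < mu)%N & x ^+ (k ^ fin_psum a mu) = x]
  | InfWord a => ~ unity_root x
  end.

(* For an infinite word, the value is +oo as soon as one term is; otherwise
   it is the sum of the finitely many nonzero terms. *)
Definition calmness x c (w : word) : \bar int :=
  match w with
  | @FinWord mu a =>
      (\sum_(i < mu) val_at (x ^+ (k ^ fin_psum a i)) (c (a i)))%E
  | InfWord a =>
      let v i := val_at (x ^+ (k ^ inf_psum a i)) (c (a i)) in
      if `[< exists i, v i = +oo%E >] then +oo%E
      else \big[+%E/0%E]_(i \in [set: nat]) v i
  end.

End Sequences.
End Calm.

(* Main.v *)
(* A nonzero polynomial h makes h^*(c) calm exactly when its order of vanishing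
   w satisfies w(x) <= v_x(c_i) + w(x^(k^i)) at every anxious x (the map
   z |-> z^(k^i) is unramified there). So w is a potential for the weighted graph
   with edges x -> x^(k^i) of cost v_x(c_i). Given h, the inequalities telescope
   along words; infinite words escape the zeros of h. Conversely take
   w(y) = max of minus the cost over the finite paths ending at y: it is finite
   because a path can be continued from y either out of all zeros and poles
   (y not a root of unity) or back to its start (y on a finite orbit), and it has
   finite support because w(y) > 0 forces y to lie after some zero or pole and,
   off the roots of unity, before another one. Then h = prod (z - y)^w(y). *)
Require Import Defs.
From mathcomp Require Import all_boot all_order all_algebra.
From mathcomp Require Import cyclic.
From mathcomp Require Import boolp classical_sets fsbigop constructive_ereal.
From mathcomp Require Import zify.

Set Implicit Arguments.
Unset Strict Implicit.
Unset Printing Implicit Defensive.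

Import Order.TTheory GRing.Theory Num.Theory.
Local Open Scope ring_scope.

(** * Multiplicities of roots of polynomials *)

Lemma mupX (F : fieldType) (x : F) (p : {poly F}) (e : nat) :
  p != 0 -> mup x (p ^+ e) = (e * mup x p)%N.
Proof.
move=> p0; elim: e => [|e IH]; first by rewrite expr0 mupNroot ?root1.
by rewrite exprS mupM ?expf_neq0 // IH mulSn.
Qed.

(** The map z -> z^m is unramified at [x]: the cofactor of z - x in z^m - x^m takes the value m
    x^(m-1) there, which is nonzero. *)
Lemma mup_comp_polyXn (F : fieldType) (x : F) (m : nat) (p : {poly F}) :
  x != 0 -> m%:R != 0 :> F -> p != 0 ->
  mup x (p \Po 'X^m) = mup (x ^+ m) p.
Proof.
move=> x0 m0 p0.
have m_gt0 : (0 < m)%N by case: m m0 => //; rewrite eqxx.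
have [e [r]] := multiplicity_XsubC p (x ^+ m); rewrite p0 /= => rN ->.
have mupD1 : mup x ('X^m - (x ^+ m)%:P) = 1%N.
  rewrite polyC_exp subrXX mupMl ?(@mup_XsubCX _ 1) ?eqxx //.
  rewrite /root horner_sum (eq_bigr (fun=> x ^+ m.-1)); last first.
    move=> i _; rewrite hornerM !hornerXn -polyC_exp hornerC -exprD.
    by congr (_ ^+ _); have := ltn_ord i; lia.
  by rewrite sumr_const card_ord -mulr_natl mulf_neq0 ?expf_neq0.
have X0 : 'X^m - (x ^+ m)%:P != 0 :> {poly F}.
  by rewrite monic_neq0 ?monicXnsubC.
rewrite rmorphM rmorphXn /= rmorphB /= comp_polyX comp_polyC.
rewrite mupMr; last by rewrite /root horner_comp hornerXn.
by rewrite mupX // mupD1 muln1 mupMr // mup_XsubCX eqxx.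
Qed.

Lemma mup_prod_XsubCX (F : fieldType) (x : F) (w : F -> nat) (s : seq F) :
  uniq s -> mup x (\prod_(y <- s) ('X - y%:P) ^+ w y) =
            (if x \in s then w x else 0)%N.
Proof.
have X0 y : ('X - y%:P) ^+ w y != 0 by rewrite expf_neq0 ?polyXsubC_eq0.
elim: s => [|y s IH] /=; first by rewrite big_nil mupNroot ?root1.
case/andP=> ys us; rewrite big_cons mupM ?prodf_seq_neq0; last 2 first.
- exact: X0.
- by apply/allP => z _; apply: X0.
rewrite mup_XsubCX IH // inE eq_sym; case: eqVneq => // ->.
by rewrite (negbTE ys) addn0.
Qed.

Lemma closed_field_roots (F : closedFieldType) (p : {poly F}) :
  p != 0 -> exists s : seq F, forall x, x \notin s -> mup x p = 0%N.
Proof.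
have [s ->] := closed_field_poly_normal p => p0; exists s => x xs.
apply: mupNroot; rewrite rootZ ?root_prod_XsubC //.
by apply: contraNneq p0 => ->; rewrite scale0r.
Qed.

(** * Orbits of anxious numbers under k-power maps *)

Section AnxiousOrbits.
Variables (K : fieldType) (k : nat).
Implicit Types (x y : K).

Lemma anxious_neq0 x : anxious_number k x -> x != 0.
Proof. by move=> ax; apply/eqP => x0; apply: ax; left. Qed.

Lemma unity_root_exp x m : (0 < m)%N -> unity_root (x ^+ m) <-> unity_root x.
Proof.
move=> m0; split=> -[d d0]; rewrite unity_rootE => /eqP xd.
  by exists (m * d)%N; rewrite ?muln_gt0 ?m0 // unity_rootE exprM xd.
by exists d => //; rewrite unity_rootE exprAC xd expr1n.
Qed.

Hypothesis k_gt1 : (1 < k)%N.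

Lemma expk_gt0 j : (0 < k ^ j)%N.
Proof. by rewrite expn_gt0 ltnW. Qed.

Lemma anxious_unity_root x : anxious_number k x -> unity_root x ->
  exists2 m, m.-primitive_root x & coprime m k.
Proof.
move=> ax [d d0]; rewrite unity_rootE => /eqP xd.
have [m xm _] := prim_order_exists d0 xd; exists m => //.
by apply: contrapT => /negP mk; apply: ax; right; exists m.
Qed.

(** If the power is a root of unity, so is [x], with order coprime to [k]; raising to [k ^ j]
    preserves that order. *)
Lemma anxious_exp x j : anxious_number k x -> anxious_number k (x ^+ (k ^ j)).
Proof.
move=> ax [/eqP|[m xm mk]].
  by rewrite expf_eq0 (negbTE (anxious_neq0 ax)) andbF.
have ux : unity_root x.
  apply/(unity_root_exp _ (expk_gt0 j)); exists m.
    exact: prim_order_gt0 xm.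
  by rewrite unity_rootE (prim_expr_order xm).
have [d xd dk] := anxious_unity_root ax ux.
have xd' : d.-primitive_root (x ^+ (k ^ j)).
  by rewrite prim_root_exp_coprime // coprimeXl // coprime_sym.
suff md : m = d by rewrite md dk in mk.
apply/eqP; rewrite eqn_dvd (prim_order_dvd xm) (prim_order_dvd xd').
by rewrite (prim_expr_order xm) (prim_expr_order xd') eqxx.
Qed.

(** By Euler's theorem, [k ^ totient m] is 1 modulo the order [m] of [x]. *)
Lemma anxious_periodic x : anxious_number k x -> unity_root x ->
  exists2 L, (0 < L)%N & x ^+ (k ^ L) = x.
Proof.
move=> ax /(anxious_unity_root ax)[m xm mk]; exists (totient m).
  by rewrite totient_gt0 (prim_order_gt0 xm).
apply/eqP; rewrite -{2}(expr1 x) (eq_prim_root_expr xm) Euler_exp_totient //.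
by rewrite coprime_sym.
Qed.

Lemma periodic_unity_root x L : x != 0 -> (0 < L)%N -> x ^+ (k ^ L) = x ->
  unity_root x.
Proof.
move=> x0 L0 xL; have kL : (1 < k ^ L)%N by rewrite -(exp1n L) ltn_exp2r.
exists (k ^ L).-1; first by lia.
rewrite unity_rootE; apply/eqP/(mulfI x0).
by rewrite -exprS prednK ?mulr1 // ltnW.
Qed.

Lemma exp_periodic x L q : x ^+ (k ^ L) = x -> x ^+ (k ^ (q * L)) = x.
Proof.
by move=> xL; elim: q => [|q IH]; rewrite ?expr1 // mulSn expnD exprM xL.
Qed.

Lemma exp_periodic_mod x L j : x ^+ (k ^ L) = x ->
  x ^+ (k ^ j) = x ^+ (k ^ (j %% L)).
Proof. by move=> xL; rewrite {1}(divn_eq j L) expnD exprM exp_periodic. Qed.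

(** The orbit meets each point of [Z] at most once: a second visit would make that point periodic,
    hence a root of unity, and [x] as well. *)
Lemma orbit_leaves x (Z : seq K) : x != 0 -> ~ unity_root x ->
  exists N, forall m, (N <= m)%N -> x ^+ (k ^ m) \notin Z.
Proof.
move=> x0 xu; elim: Z => [|z Z [N NZ]]; first by exists 0%N.
have [[j xj]|nz] := pselect (exists j, x ^+ (k ^ j) = z); last first.
  exists N => m Nm; rewrite inE negb_or NZ // andbT.
  by apply/eqP => xm; apply: nz; exists m.
exists (maxn N j.+1) => m; rewrite geq_max => /andP[Nm jm].
rewrite inE negb_or NZ // andbT; apply/eqP => xm; apply: xu.
apply/(unity_root_exp x (expk_gt0 j)).
apply: (@periodic_unity_root _ (m - j)); rewrite ?expf_neq0 ?subn_gt0 //.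
by rewrite -exprM -expnD subnKC ?xm // ltnW.
Qed.

End AnxiousOrbits.

(** * Path costs and potentials *)

Section Potential.
Variables (K : fieldType) (k n : nat).
Variable V : K -> 'I_n -> int.
Implicit Types (x y z : K) (l : seq 'I_n).

Definition wt l : nat := \sum_(i <- l) i.+1.

(* The sum of [V] along the path from [x] to [x ^+ (k ^ wt l)] spelled by
   [l]. *)
Fixpoint cost x l : int :=
  if l is i :: l' then V x i + cost (x ^+ (k ^ i.+1)) l' else 0.

Lemma wt_cons i l : wt (i :: l) = (i.+1 + wt l)%N.
Proof. by rewrite /wt big_cons. Qed.

Lemma wt_cat l1 l2 : wt (l1 ++ l2) = (wt l1 + wt l2)%N.
Proof. by rewrite /wt big_cat. Qed.

Lemma wt_repeat m l : wt (flatten (nseq m l)) = (m * wt l)%N.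
Proof.
elim: m => [|m IH]; first by rewrite /wt big_nil.
by rewrite /= wt_cat IH mulSn.
Qed.

Lemma leq_size_wt l : (size l <= wt l)%N.
Proof. by elim: l => //= i l IH; rewrite wt_cons; lia. Qed.

Lemma cost_cat x l1 l2 :
  cost x (l1 ++ l2) = cost x l1 + cost (x ^+ (k ^ wt l1)) l2.
Proof.
elim: l1 x => [|i l1 IH] x /=; first by rewrite /wt big_nil expr1 add0r.
by rewrite IH wt_cons expnD exprM addrA.
Qed.

Lemma wt_mkseq (s : nat -> 'I_n) N : wt (mkseq s N) = inf_psum s N.
Proof. by rewrite /wt /inf_psum big_map -{1}[N]subn0 big_mkord. Qed.

Lemma cost_mkseq x (s : nat -> 'I_n) N :
  cost x (mkseq s N) = \sum_(i < N) V (x ^+ (k ^ inf_psum s i)) (s i).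
Proof.
elim: N => [|N IH]; first by rewrite big_ord0.
rewrite mkseqS -cats1 cost_cat big_ord_recr /= IH addr0.
by rewrite wt_mkseq.
Qed.

Section Existence.
Hypothesis k_gt1 : (1 < k)%N.
Variables (A : pred 'I_n) (Z : seq K).

Hypothesis V_support : forall x i, A i -> x \notin Z -> V x i = 0.

Hypothesis cycle_ge0 : forall x l, anxious_number k x -> all A l ->
  x ^+ (k ^ wt l) = x -> 0 <= cost x l.

(** The condition on infinite words in finite form: once the end of [l] and its forward orbit avoid
    [Z], further letters of [A] cost nothing. *)
Hypothesis escape_ge0 : forall x l, anxious_number k x -> all A l ->
  ~ unity_root x -> (forall m, x ^+ (k ^ (wt l + m)) \notin Z) ->
  0 <= cost x l.

Definition ends_at y x l : Prop :=
  [/\ anxious_number k x, all A l & x ^+ (k ^ wt l) = y].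

Lemma ends_at_unity y x l : ends_at y x l -> unity_root y <-> unity_root x.
Proof. by case=> ax _ <-; apply: unity_root_exp; rewrite expk_gt0. Qed.

Lemma cost_bounded_unity y : anxious_number k y -> unity_root y ->
  exists B : int, forall x l, ends_at y x l -> B <= cost x l.
Proof.
move=> ay uy; have [L L0 yL] := anxious_periodic ay uy.
(* A path from [y ^+ (k ^ j)] to [y], repeated [L - 1] times from [y], leads
   back, so all such paths are bounded by the cost of that fixed return. *)
have bound_upto J : exists B : int, forall j l, (j < J)%N ->
    ends_at y (y ^+ (k ^ j)) l -> B <= cost (y ^+ (k ^ j)) l.
  elim: J => [|J [B HB]]; first by exists 0.
  have [[l0 [a0 Al0 e0]]|no] :=
    pselect (exists l, ends_at y (y ^+ (k ^ J)) l); last first.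
    exists B => j l; rewrite ltnS leq_eqVlt => /orP[/eqP->|jJ]; last exact: HB.
    by move=> el; case: no; exists l.
  pose r := flatten (nseq L.-1 l0).
  have Ar : all A r.
    by rewrite /r; elim: L.-1 => //= m IH; rewrite all_cat Al0.
  exists (Num.min B (- cost y r)) => j l; rewrite ltnS leq_eqVlt => /orP[/eqP->|jJ].
    case=> ax Al e; rewrite ge_min; apply/orP; right.
    have : 0 <= cost (y ^+ (k ^ J)) (l ++ r).
      apply: cycle_ge0; rewrite ?all_cat ?Al //.
      rewrite wt_cat expnD exprM e wt_repeat -{1}e0 -exprM -expnD.
      have -> : (wt l0 + L.-1 * wt l0 = wt l0 * L)%N.
        by rewrite -mulSn prednK // mulnC.
      by apply: exp_periodic; rewrite -exprM mulnC exprM yL.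
    by rewrite cost_cat e; lia.
  by move=> /(HB _ _ jJ) h; rewrite ge_min h.
have [B HB] := bound_upto L; exists B => x l xl.
case: (xl) => ax Al e.
have ux : unity_root x by apply/(ends_at_unity xl).
have [M M0 xM] := anxious_periodic ax ux.
(* The source lies on the cycle of [y]: the exponent [k ^ (M * wt l)] fixes [x], and its first
   [wt l] steps lead to [y]. *)
have xy : x = y ^+ (k ^ ((M.-1 * wt l) %% L)).
  rewrite -exp_periodic_mod // -e -exprM -expnD -mulSn prednK // mulnC.
  by rewrite exp_periodic.
by rewrite xy; apply: HB; rewrite ?ltn_mod -?xy.
Qed.

(** Continuing by [N] letters [i0] moves past all of [Z], so the continued path has nonnegative
    cost; the cost of the continuation depends only on [y]. *)
Lemma cost_bounded_nonunity i0 y : A i0 -> anxious_number k y ->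
  ~ unity_root y ->
  exists B : int, forall x l, ends_at y x l -> B <= cost x l.
Proof.
move=> Ai0 ay uy.
have [N HN] := orbit_leaves k_gt1 Z (anxious_neq0 ay) uy.
exists (- cost y (nseq N i0)) => x l xl; case: (xl) => ax Al e.
have : 0 <= cost x (l ++ nseq N i0).
  apply: escape_ge0 => //; first by rewrite all_cat Al all_nseq Ai0 orbT.
    by move=> ux; apply/uy/(ends_at_unity xl).
  move=> m; rewrite wt_cat -addnA expnD exprM e; apply: HN.
  by rewrite (leq_trans _ (leq_addr _ _)) // -{1}(size_nseq N i0) leq_size_wt.
by rewrite cost_cat e; lia.
Qed.

Lemma cost_bounded i0 y : A i0 -> anxious_number k y ->
  exists B : int, forall x l, ends_at y x l -> B <= cost x l.
Proof.
move=> Ai0 ay; have [uy|uy] := pselect (unity_root y).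
  exact: cost_bounded_unity.
exact: cost_bounded_nonunity Ai0 ay uy.
Qed.

(* [m] is minus the least cost of a path ending at [y]; it is nonnegative
   because of the empty path. *)
Definition is_best y (m : nat) : Prop :=
  (exists x l, ends_at y x l /\ cost x l = - m%:Z) /\
  (forall x l, ends_at y x l -> - m%:Z <= cost x l).

Lemma best_exists i0 y : A i0 -> anxious_number k y -> exists m, is_best y m.
Proof.
move=> Ai0 ay; have [B HB] := cost_bounded Ai0 ay.
pose P m := `[< exists x l, ends_at y x l /\ cost x l = - m%:Z >].
have P0 : exists m, P m.
  exists 0%N; apply/asboolP; exists y, [::]; split => //.
  by split; rewrite // /wt big_nil expr1.
have Pb m : P m -> (m <= `|B|)%N.
  by move=> /asboolP[x [l [xl e]]]; have := HB _ _ xl; lia.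
case: (ex_maxnP P0 Pb) => m /asboolP Pm max_m; exists m; split=> // x l xl.
have [c0|c0] := leP 0 (cost x l); first by lia.
have /max_m : P `|cost x l|%N.
  by apply/asboolP; exists x, l; split => //; lia.
by lia.
Qed.

(** Appending the edge [i] to an optimal path ending at [x] gives a competitor at the next point. *)
Lemma best_step x i m m' : anxious_number k x -> A i ->
  is_best x m -> is_best (x ^+ (k ^ i.+1)) m' -> m%:Z <= V x i + m'%:Z.
Proof.
move=> ax Ai [[x0 [l [[a0 Al e] c]]] _] [_ best].
have : - m'%:Z <= cost x0 (l ++ [:: i]).
  apply: best; split; rewrite ?all_cat ?Al /= ?Ai //.
  by rewrite wt_cat expnD exprM e wt_cons /wt big_nil addn0.
by rewrite cost_cat e c /=; lia.
Qed.

Lemma cost_neq0 x l : all A l -> cost x l != 0 ->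
  exists2 j, (j <= wt l)%N & x ^+ (k ^ j) \in Z.
Proof.
elim: l x => [|i l IH] x /=; first by [].
case/andP=> Ai Al; have [xZ _|xZ] := boolP (x \in Z).
  by exists 0%N; rewrite ?expr1.
rewrite V_support // add0r => /IH[//|j jl h].
by exists (i.+1 + j)%N; rewrite ?wt_cons ?leq_add2l // expnD exprM.
Qed.

(** The orbit of a root of unity is finite. Otherwise, past the last visit to [Z], every path ending
    on the orbit has nonnegative cost, which forces [m] to be 0. *)
Lemma best_support z : anxious_number k z -> exists S : seq K, forall j m,
  is_best (z ^+ (k ^ j)) m -> m != 0%N -> z ^+ (k ^ j) \in S.
Proof.
move=> az; have [uz|uz] := pselect (unity_root z).
  have [L L0 zL] := anxious_periodic az uz.
  exists (mkseq (fun j => z ^+ (k ^ j)) L) => j m _ _.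
  by rewrite (exp_periodic_mod j zL); apply/mapP; exists (j %% L)%N; rewrite // mem_iota ltn_mod.
have [N HN] := orbit_leaves k_gt1 Z (anxious_neq0 az) uz.
exists (mkseq (fun j => z ^+ (k ^ j)) N) => j m [[x [l [xl c]]] _] m0.
apply/mapP; exists j; rewrite // mem_iota /= ltnNge; apply: contra_neqN m0 => Nj.
case: (xl) => ax Al e.
suff : 0 <= cost x l by rewrite c; lia.
apply: escape_ge0 => //.
  move=> ux; apply/uz/(unity_root_exp z (expk_gt0 k_gt1 j)).
  by apply/(ends_at_unity xl).
move=> a; rewrite expnD exprM e -exprM -expnD; apply: HN.
by rewrite (leq_trans Nj) ?leq_addr.
Qed.

(** A positive value comes from a path of nonzero cost, which visits [Z]; so [y] lies on the forward
    orbit of one of finitely many anxious points of [Z]. *)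
Lemma finite_support : exists S : seq K, forall y m,
  is_best y m -> m != 0%N -> y \in S.
Proof.
have [S HS] : exists S : seq K, forall z, z \in Z -> anxious_number k z ->
    forall j m, is_best (z ^+ (k ^ j)) m -> m != 0%N -> z ^+ (k ^ j) \in S.
  elim: (Z) => [|z Z' [S HS]]; first by exists [::].
  have [T HT] : exists T : seq K, anxious_number k z -> forall j m,
      is_best (z ^+ (k ^ j)) m -> m != 0%N -> z ^+ (k ^ j) \in T.
    have [/best_support[T HT]|] := pselect (anxious_number k z); first by exists T.
    by exists [::].
  exists (T ++ S) => z' /[!inE] /orP[/eqP->|z'Z] a j m b m0; rewrite mem_cat.
    by rewrite (HT a _ _ b m0).
  by rewrite (HS _ z'Z a _ _ b m0) orbT.
exists S => y m b m0; case: (b) => -[x [l [[ax Al e] c]]] _.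
have [|j jl xj] := cost_neq0 (x := x) Al; first by rewrite c; lia.
have ey : y = (x ^+ (k ^ j)) ^+ (k ^ (wt l - j)).
  by rewrite -exprM -expnD subnKC.
rewrite ey; apply: (HS _ xj _ _ m _ m0); first exact: anxious_exp.
by rewrite -ey.
Qed.

Lemma potential_exists : exists (w : K -> nat) (S : seq K),
  (forall x, x \notin S -> w x = 0%N) /\
  (forall x i, anxious_number k x -> A i ->
     (w x)%:Z <= V x i + (w (x ^+ (k ^ i.+1)))%:Z).
Proof.
have [[i0 Ai0]|noA] := pselect (exists i, A i); last first.
  by exists (fun=> 0%N), [::]; split => // x i _ Ai; case: noA; exists i.
(* The value 0 at calm points keeps the support finite. *)
have /choice[w Hw] : forall y, exists m,
    (anxious_number k y -> is_best y m) /\ (~ anxious_number k y -> m = 0%N).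
  move=> y; have [ay|ay] := pselect (anxious_number k y).
    by have [m bm] := best_exists Ai0 ay; exists m.
  by exists 0%N.
have [S HS] := finite_support; exists w, S; split.
  move=> x; apply: contraNeq => w0.
  have [ax|ax] := pselect (anxious_number k x).
    exact: HS ((Hw x).1 ax) w0.
  by rewrite ((Hw x).2 ax) in w0.
move=> x i ax Ai; apply: best_step => //; first exact: (Hw x).1.
by apply: (Hw _).1; apply: anxious_exp.
Qed.

End Existence.
End Potential.

(** * Valuations and calmness expressed as path costs *)

Lemma fin_psum_nat n (s : nat -> 'I_n) (i N : nat) : (i <= N)%N ->
  fin_psum (fun j : 'I_N => s j) i = inf_psum s i.
Proof.
by move=> iN; rewrite /inf_psum (big_ord_widen N (fun j => (s j).+1)).
Qed.

Section Valuations.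
Variables (K : closedFieldType) (k n : nat).
Hypothesis k_gt1 : (1 < k)%N.
Hypothesis k_coprime : forall p : nat, p \in [pchar K] -> coprime k p.
Variable c : 'I_n -> ratfun K.
Implicit Types (x : K) (h : {poly K}).

Definition nonzero : pred 'I_n := fun i => c i != 0.

(** Path costs must be integers; zero entries, whose valuation is [+oo], are kept out of the paths
    by [nonzero]. *)
Definition val x i : int :=
  (mup x \n_(repr (c i)))%:Z - (mup x \d_(repr (c i)))%:Z.

Lemma val_at_nonzero x i : nonzero i -> val_at x (c i) = (val x i)%:E.
Proof. by rewrite /val_at /nonzero => /negbTE ->. Qed.

Lemma val_at_zero x i : ~~ nonzero i -> val_at x (c i) = +oo%E.
Proof. by rewrite /val_at /nonzero negbK => ->. Qed.

(** Coprimality with the characteristic enters here: if [k ^ j] vanished in [K], the characteristic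
    would divide [k]. *)
Lemma natr_expk_neq0 j : (k ^ j)%:R != 0 :> K.
Proof.
rewrite natrX expf_neq0 //; apply/negP => k0.
have [p pK] := natf0_pchar (ltnW k_gt1) k0.
have := k_coprime pK; rewrite coprime_sym prime_coprime ?(pcharf_prime pK) //.
by rewrite (dvdn_pcharf pK) k0.
Qed.

Lemma val_at_star h x i : h != 0 -> nonzero i -> x != 0 ->
  val_at x (star k h%:F c i) =
  ((mup (x ^+ (k ^ i.+1)) h)%:Z - (mup x h)%:Z + val x i)%:E.
Proof.
move=> h0 ci x0; rewrite /star subst_pow_poly ?expk_gt0 //.
have n0 : \n_(repr (c i)) != 0 :> {poly K} by rewrite numer_repr_eq0.
have hX0 : h \Po 'X^(k ^ i.+1) != 0.
  by rewrite comp_poly_eq0 ?size_polyXn // ltnS expk_gt0.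
rewrite [X in _ * X](ratfun_repr (c i)) mulrACA -invfM -!tofracM.
rewrite val_at_frac ?mulf_neq0 ?denom_ratioP // !mupM ?denom_ratioP //.
by rewrite mup_comp_polyXn ?natr_expk_neq0 // /val !PoszD opprD addrACA.
Qed.

(** Zero entries stay zero under [star] and have no poles; for the others the inequality says that
    the valuation in [val_at_star] is nonnegative. *)
Lemma calm_star h : h != 0 ->
  calm_seq k (star k h%:F c) <->
  (forall x i, anxious_number k x -> nonzero i ->
     (mup x h)%:Z <= val x i + (mup (x ^+ (k ^ i.+1)) h)%:Z).
Proof.
move=> h0; split=> [ch x i ax ci|H i x ax].
  have := ch i x ax; rewrite /has_pole val_at_star ?(anxious_neq0 ax) //.
  by rewrite lte_fin; lia.
have [ci|ci] := boolP (nonzero i); last first.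
  have /eqP c0 : c i == 0 by rewrite -[_ == _]negbK.
  by rewrite /has_pole /star c0 mulr0 /val_at eqxx.
rewrite /has_pole val_at_star ?(anxious_neq0 ax) // lte_fin.
by have := H x i ax ci; lia.
Qed.

(** The numerators and denominators have finitely many roots in all; common factors of a
    representative only enlarge [Z]. *)
Lemma zeros_and_poles : exists Z : seq K, forall x i,
  nonzero i -> x \notin Z -> val x i = 0.
Proof.
pose p : {poly K} :=
  \prod_(i | nonzero i) (\n_(repr (c i)) * \d_(repr (c i))).
have nd0 i : nonzero i -> \n_(repr (c i)) * \d_(repr (c i)) != 0 :> {poly K}.
  by move=> ci; rewrite mulf_neq0 ?denom_ratioP // numer_repr_eq0.
have p0 : p != 0 by apply/prodf_neq0.
have [Z HZ] := closed_field_roots p0; exists Z => x i ci /HZ.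
have rest0 : \prod_(j | nonzero j && (j != i))
    (\n_(repr (c j)) * \d_(repr (c j))) != 0 :> {poly K}.
  by apply/prodf_neq0 => j /andP[/nd0].
rewrite /p (bigD1 i) //= mupM ?nd0 // mupM ?denom_ratioP ?numer_repr_eq0 //.
by move/eqP; rewrite !addn_eq0 /val => /andP[/andP[/eqP-> /eqP->] _].
Qed.

Lemma calmness_fin x (s : nat -> 'I_n) N : all nonzero (mkseq s N) ->
  calmness k x c (FinWord (fun i : 'I_N => s i)) = (cost k val x (mkseq s N))%:E.
Proof.
move=> /allP sN /=; rewrite cost_mkseq -sumEFin; apply: eq_bigr => i _.
rewrite (fin_psum_nat s (ltnW (ltn_ord i))) val_at_nonzero //.
by apply: sN; rewrite map_f // mem_iota /=.
Qed.

Lemma calmness_inf x (s : nat -> 'I_n) N :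
  (forall i, nonzero (s i)) ->
  (forall i, (N <= i)%N -> val (x ^+ (k ^ inf_psum s i)) (s i) = 0) ->
  calmness k x c (InfWord s) = (cost k val x (mkseq s N))%:E.
Proof.
move=> s0 sN /=; case: ifPn => [/asboolP[i]|_]; first by rewrite val_at_nonzero.
rewrite cost_mkseq -sumEFin; apply/esym.
rewrite (eq_bigr (fun i : 'I_N =>
  val_at (x ^+ (k ^ inf_psum s i)) (c (s i)))); last first.
  by move=> i _; rewrite val_at_nonzero.
rewrite (fsbig_ord _ N (fun i => val_at (x ^+ (k ^ inf_psum s i)) (c (s i)))).
apply: fsbig_widen => // i /= [_ /negP]; rewrite -leqNgt => Ni.
by rewrite val_at_nonzero // sN.
Qed.

(** Presents a finite word as the beginning of a sequence on [nat], so that both kinds of words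
    reduce to lists [mkseq s N]. *)
Lemma ord_fun_extend (mu : nat) (a : 'I_mu -> 'I_n) : (0 < mu)%N ->
  exists s : nat -> 'I_n, a = (fun i : 'I_mu => s i).
Proof.
case: mu a => // mu a _; exists (fun j => a (inord j)).
by apply/funext => i; rewrite inord_val.
Qed.

(** No valuation is [-oo], so a single infinite term makes the sum [+oo]. *)
Lemma calmness_fin_zero x (mu : nat) (a : 'I_mu -> 'I_n) (i : 'I_mu) :
  ~~ nonzero (a i) -> calmness k x c (FinWord a) = +oo%E.
Proof.
move=> ai /=; apply/eqP; rewrite esum_eqy; last first.
  by move=> j _; rewrite /val_at; case: ifP.
by apply/existsP; exists i; rewrite val_at_zero.
Qed.

Lemma cost_telescope (w : K -> int) x l :
  (forall y i, anxious_number k y -> nonzero i ->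
     w y <= val y i + w (y ^+ (k ^ i.+1))) ->
  anxious_number k x -> all nonzero l ->
  w x <= cost k val x l + w (x ^+ (k ^ wt l)).
Proof.
move=> Hw; elim: l x => [|i l IH] x ax /=.
  by rewrite /wt big_nil expr1 add0r.
case/andP=> ci cl; rewrite wt_cons expnD exprM -addrA.
apply: le_trans (Hw x i ax ci) _; rewrite lerD2l.
exact: IH (anxious_exp k_gt1 ax) cl.
Qed.

(** * The two implications *)

Lemma precalm_calmness : precalm k c ->
  forall x, anxious_number k x ->
  forall a : word n, admissible k x a -> (0 <= calmness k x c a)%E.
Proof.
case=> h h0 /(calm_star h0) pot x ax [mu a|s].
  case=> ux mu0.
  have [[i ci]|all0] := pselect (exists i, ~~ nonzero (a i)).
    by rewrite (calmness_fin_zero x ci).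
  have [s E] := ord_fun_extend a mu0; rewrite {}E in all0 *.
  rewrite fin_psum_nat // -wt_mkseq => xa.
  have sN : all nonzero (mkseq s mu).
    apply/allP => _ /mapP[i + ->]; rewrite mem_iota /= => i_mu.
    by apply: contrapT => /negP ci; apply: all0; exists (Ordinal i_mu).
  rewrite calmness_fin // lee_fin.
  (* The path is closed, so the multiplicities of [h] at its two ends cancel. *)
  by have := cost_telescope pot ax sN; rewrite xa lerDr.
move=> nux.
have [[i vi]|fin] := pselect (exists i,
    val_at (x ^+ (k ^ inf_psum s i)) (c (s i)) = +oo%E).
  by rewrite /calmness; case: ifPn => // /asboolP[]; exists i.
have s0 i : nonzero (s i).
  by apply: contrapT => /negP si; apply: fin; exists i; rewrite val_at_zero.
have [Z HZ] := zeros_and_poles; have [R HR] := closed_field_roots h0.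
(* Past [N] the orbit avoids [Z], which truncates the sum, and the roots of [h], which makes the
   final potential 0. *)
have [N HN] := orbit_leaves k_gt1 (Z ++ R) (anxious_neq0 ax) nux.
have leaves i : (N <= i)%N -> x ^+ (k ^ inf_psum s i) \notin Z ++ R.
  (* Each letter weighs at least 1, so the exponent after [i] letters is at least [i]. *)
  move=> Ni; apply: HN; rewrite -wt_mkseq (leq_trans Ni) //.
  by rewrite -{1}(size_mkseq s i) leq_size_wt.
have leavesZ i : (N <= i)%N -> x ^+ (k ^ inf_psum s i) \notin Z.
  by move=> /leaves; rewrite mem_cat => /norP[].
rewrite (@calmness_inf x s N) //; last by move=> i Ni; rewrite HZ ?leavesZ.
have sN : all nonzero (mkseq s N) by apply/allP => _ /mapP[i _ ->].
have hN : mup (x ^+ (k ^ wt (mkseq s N))) h = 0%N.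
  apply: HR; have := leaves N (leqnn N).
  by rewrite mem_cat wt_mkseq => /norP[].
have := cost_telescope pot ax sN; rewrite hN.
by rewrite addr0 lee_fin; apply: le_trans.
Qed.

Lemma calmness_precalm :
  (forall x, anxious_number k x ->
     forall a : word n, admissible k x a -> (0 <= calmness k x c a)%E) ->
  precalm k c.
Proof.
move=> H; have [Z HZ] := zeros_and_poles.
have [||w [S [wS wP]]] := potential_exists (V := val) k_gt1 (A := nonzero) HZ.
- move=> x [//|i l] ax cl xl; set l' := i :: l in cl xl *.
  rewrite -[l'](mkseq_nth i) in cl xl *.
  rewrite -lee_fin -calmness_fin //; apply: H => //; split => //.
    apply: (periodic_unity_root k_gt1 (anxious_neq0 ax) _ xl).
    by rewrite wt_mkseq /inf_psum big_ord_recl.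
  by rewrite fin_psum_nat // -wt_mkseq.
- move=> x [//|i l] ax cl nux out; set l' := i :: l in cl out *.
  (* The default of [nth] is the first letter [i]: the path is prolonged by repeating [i] forever
     and stays within [nonzero]. *)
  pose s := nth i l'.
  have el : mkseq s (size l') = l' by rewrite mkseq_nth.
  have s0 j : nonzero (s j).
    have [jl|jl] := ltnP j (size l'); first exact: (all_nthP i cl).
    by rewrite /s nth_default //; case/andP: cl.
  rewrite -el -lee_fin -(calmness_inf s0); first exact: H.
  move=> j jl; apply: HZ => //; rewrite -wt_mkseq.
  (* The first [j] letters start with all of [l'], so [out] applies to the point they reach. *)
  have [m ->] : exists m, wt (mkseq s j) = (wt l' + m)%N.
    exists (wt (drop (size l') (mkseq s j))).
    have tl : take (size l') (mkseq s j) = l'.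
      by rewrite -map_take take_iota (minn_idPl jl).
    by rewrite -[in LHS](cat_take_drop (size l') (mkseq s j)) tl wt_cat.
  exact: out.
(* Repetitions in [S] would multiply the order of vanishing, hence [undup]. *)
pose h : {poly K} := \prod_(y <- undup S) ('X - y%:P) ^+ w y.
have h0 : h != 0.
  by rewrite prodf_seq_neq0; apply/allP => y _; rewrite expf_neq0 ?polyXsubC_eq0.
have mh x : mup x h = w x.
  rewrite mup_prod_XsubCX ?undup_uniq // mem_undup.
  by case: ifPn => // /wS.
by exists h => //; apply/(calm_star h0) => x i; rewrite !mh; apply: wP.
Qed.
End Valuations.

Unset Implicit Arguments.

Theorem theorem5 (K : closedFieldType) (k : nat) (k_ge2 : (2 <= k)%N)
    (k_coprime : forall p : nat, p \in [pchar K] -> coprime k p)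
    (n : nat) (c : 'I_n -> ratfun K) :
  precalm k c <->
  (forall x : K, anxious_number k x ->
     forall a : word n, admissible k x a -> (0 <= calmness k x c a)%E).
Proof.
split; first exact: precalm_calmness.
exact: calmness_precalm.
Qed.
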